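(* Let $k$ be a field, let $a,b,c$ be pairwise coprime positive integers, and set $\xi=abc$ and $\eta=a+b+c$. Assume $\sqrt{\xi}>\eta$. Let $S=k[x,y,z]$ be graded by $\deg x=a$, $\deg y=b$, $\deg z=c$, with $S_n$ its homogeneous component of degree $n$. Suppose that there exist positive integers $n_1$ and $r_1$ such that $n_1/r_1<\sqrt{\xi}$ and $\dim_k S_{n_1}>r_1(r_1+1)/2$. Write $n_1=\xi q_1+v_1$, where $q_1$ and $v_1$ are integers with $0\le v_1<\xi$. Then \[ q_1<\frac{2\dim_k S_{v_1}}{\sqrt{\xi}-\eta}. \] In particular, \[ n_1=\xi q_1+v_1<\frac{2\xi\,\max\{\dim_k S_t\mid 0\le t<\xi\}}{\sqrt{\xi}-\eta}+\xi . \] *)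

(* Defs.v *)
From HB Require Import structures.
From mathcomp Require Import all_boot all_order all_algebra.
From mathcomp Require Import mpoly.

Set Implicit Arguments.
Unset Strict Implicit.
Unset Printing Implicit Defensive.

Import GRing.Theory.

Local Open Scope ring_scope.

(* Positivity of the weights is what makes the graded pieces finite           *)
(* dimensional; it is carried by the type so that they are vectTypes.         *)
Record weights (n : nat) := Weights {
  wval :> n.-tuple nat;
  wval_gt0 : forall i, (0 < tnth wval i)%N }.

Section WeightedDegree.
Context (n : nat) (w : weights n).

Definition wdeg (m : 'X_{1..n}) : nat := (\sum_(i < n) tnth w i * m i)%N.

Lemma wdeg0 : wdeg 0%MM = 0%N.
Proof. by rewrite /wdeg big1 // => i _; rewrite mnm0E muln0. Qed.

Lemma wdegD : {morph wdeg : m1 m2 / (m1 + m2)%MM >-> (m1 + m2)%N}.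
Proof.
move=> m1 m2; rewrite /wdeg -big_split /=.
by apply: eq_bigr => i _; rewrite mnmDE mulnDr.
Qed.

HB.instance Definition _ := isMeasure.Build n wdeg wdeg0 wdegD.

Lemma mdeg_le_wdeg m : (mdeg m <= wdeg m)%N.
Proof.
by rewrite mdegE leq_sum // => i _; rewrite leq_pmull // wval_gt0.
Qed.

End WeightedDegree.

(* The homogeneous component of degree d of k[x_0, .., x_(n-1)] graded by     *)
(* deg x_i = w_i.                                                             *)
Section GradedComponent.
Context (k : fieldType) (n : nat) (w : weights n) (d : nat).

Record gcomp := GComp {
  mpoly_of_gcomp :> {mpoly k[n]};
  _ : mpoly_of_gcomp \is d.-homog for (wdeg w) }.

HB.instance Definition _ := [isSub for mpoly_of_gcomp].
HB.instance Definition _ := [Choice of gcomp by <:].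
HB.instance Definition _ := [SubChoice_isSubLmodule of gcomp by <:].

(* The monomials of weighted degree d: since the weights are positive, their  *)
(* ordinary degree is at most d.                                              *)
Definition gmon := {m : 'X_{1..n < d.+1} | wdeg w m == d}.

Definition gcoef (p : gcomp) : 'rV[k]_#|{: gmon}| :=
  \row_i (val p)@_(val (val (enum_val i))).

Lemma gcoef_linear : linear gcoef.
Proof. by move=> c p q; apply/rowP => i; rewrite !mxE /= mcoeffD mcoeffZ. Qed.

Lemma gcoef_bij : bijective gcoef.
Proof.
pose g (v : 'rV[k]_#|{: gmon}|) : {mpoly k[n]} :=
  \sum_i v 0 i *: 'X_[val (val (enum_val i))].
have g_homog v : g v \is d.-homog for (wdeg w).
  apply: rpred_sum => i _; apply: rpredZ.
  by rewrite dhomogX; exact: (valP (enum_val i)).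
have coefg v i : (g v)@_(val (val (enum_val i))) = v 0 i.
  rewrite raddf_sum (bigD1 i) //= mcoeffZ mcoeffX eqxx mulr1.
  rewrite big1 ?addr0 // => j ne_ji; rewrite mcoeffZ mcoeffX.
  case: eqP => [/val_inj/val_inj/enum_val_inj e|]; last by rewrite mulr0.
  by rewrite e eqxx in ne_ji.
exists (fun v => GComp (g_homog v)) => [p|v]; last first.
  by apply/rowP => i; rewrite mxE /= coefg.
apply: val_inj; apply/mpolyP => m /=.
have [wm|wm] := eqVneq (wdeg w m) d; last first.
  rewrite (dhomog_nemf_coeff (g_homog _) wm).
  by rewrite (dhomog_nemf_coeff (valP p) wm).
have lt_m : (mdeg m < d.+1)%N by rewrite ltnS -wm mdeg_le_wdeg.
have wm' : wdeg w (BMultinom lt_m) == d by rewrite /= wm.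
pose j : gmon := Sub (BMultinom lt_m) wm'.
by have := coefg (gcoef p) (enum_rank j); rewrite mxE enum_rankK.
Qed.

HB.instance Definition _ := Lmodule_hasFinDim.Build k gcomp
  (exist2 _ _ gcoef gcoef_linear gcoef_bij).

End GradedComponent.

Lemma weights3_gt0 (a b c : nat) :
  (0 < a)%N -> (0 < b)%N -> (0 < c)%N ->
  forall i, (0 < tnth [tuple a; b; c] i)%N.
Proof. by move=> a0 b0 c0 i; case: i => [[|[|[|i]]] lti]. Qed.

Definition weights3 (a b c : nat)
    (a_gt0 : (0 < a)%N) (b_gt0 : (0 < b)%N) (c_gt0 : (0 < c)%N) : weights 3 :=
  Weights (weights3_gt0 a_gt0 b_gt0 c_gt0).

Definition dimS (k : fieldType) (n : nat) (w : weights n) (d : nat) : nat :=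
  \dim {: gcomp k w d}.

Lemma dimSE (k : fieldType) (n : nat) (w : weights n) (d : nat) :
  dimS k w d = #|{: gmon w d}|.
Proof. exact: dimvf. Qed.

(* Main.v *)
(* Let N(n) be the number of monomials of weighted degree n, xi = abc and
   eta = a + b + c. Then 2 N(n + xi) = 2 N(n) + 2n + xi + eta: the monomials not
   divisible by x^(bc) contribute the sum of the counts for (b, c) at n + xi - ai,
   i < bc, and as a is invertible mod bc these arguments run once through all
   residues mod bc. Summing over q periods,
   2 N(xi q + v) = 2 N(v) + xi q^2 + 2 q v + q eta.
   For u = n1 / sqrt xi < r1 the hypothesis gives u^2 + u < 2 N(n1); with
   n1 = xi q + v the quadratic terms cancel, leaving
   q (sqrt xi - eta) < 2 N(v). *)
Require Import Defs.
From mathcomp Require Import all_boot all_order all_algebra.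
From mathcomp Require Import mpoly.
From mathcomp Require Import zify ring lra.
Import Order.TTheory GRing.Theory Num.Theory.
Local Open Scope ring_scope.

(** * Shift formulas for denumerants of two and three coprime weights *)

Section Denumerant.
Local Open Scope nat_scope.

(* Its generating series is that of g divided by 1 - T^a. *)
Definition weighted_conv (a : nat) (g : nat -> nat) (n : nat) : nat :=
  \sum_(i < n.+1 | a * i <= n) g (n - a * i).

(** The filter already discards every index beyond n / a, so the cutoff [n.+1] in the definition is
    only one choice. A cutoff independent of [n] is what later allows sums to be exchanged. *)
Lemma weighted_conv_widen a g n N : n < a * N ->
  weighted_conv a g n = \sum_(i < N | a * i <= n) g (n - a * i).
Proof.
move=> lt_n.
have a_gt0 : 0 < a by case: a lt_n.
have aux M : n < a * M -> \sum_(i < M | a * i <= n) g (n - a * i)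
    = \sum_(i < n.+1 + M | a * i <= n) g (n - a * i).
  move=> ltM; rewrite addnC big_split_ord /= [X in _ = _ + X]big1 ?addn0 // => i.
  move=> le_n; exfalso.
  by have := leq_mul2l a M (M + i); rewrite leq_addr orbT; lia.
rewrite aux // /weighted_conv [RHS]big_split_ord /= [X in _ = _ + X]big1 ?addn0 //.
by move=> i; have := leq_pmull (n.+1 + i) a_gt0; lia.
Qed.

(** The first [m] indices all pass the filter; the substitution of [m + i] for [i] turns the others
    into the convolution at [n]. *)
Lemma weighted_conv_shift a m g n : 0 < a ->
  weighted_conv a g (n + a * m)
    = \sum_(i < m) g (n + a * m - a * i) + weighted_conv a g n.
Proof.
move=> a_gt0; rewrite (@weighted_conv_widen _ _ _ (m + n.+1)); last first.
  by rewrite mulnDr addnC ltn_add2l; have := leq_pmull n.+1 a_gt0; lia.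
rewrite big_split_ord /=; congr (_ + _).
  apply: eq_bigl => i; have := ltn_ord i => /ltnW lt_i.
  by have := leq_mul2l a i m; rewrite lt_i orbT; lia.
rewrite /weighted_conv; apply: eq_big => i; first by rewrite mulnDr addnC leq_add2r.
by move=> _; congr g; rewrite mulnDr; lia.
Qed.

(** Multiplication by [a] permutes the residues mod [m]; the bound on [s] keeps the subtraction from
    truncating. *)
Lemma coprime_residue_sum a m s (h : nat -> nat) : coprime a m -> a * m <= s ->
  \sum_(i < m) h ((s - a * i) %% m) = \sum_(r < m) h r.
Proof.
move=> co_am le_s.
pose f (i : 'I_m) : 'I_m :=
  Ordinal (ltn_pmod (s - a * i) (leq_ltn_trans (leq0n i) (ltn_ord i))).
have le_f (i : 'I_m) : a * i <= s.
  by apply: leq_trans le_s; rewrite leq_mul2l (ltnW (ltn_ord i)) orbT.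
suff inj_f : injective f by rewrite [RHS](reindex_inj inj_f).
move=> i j /(congr1 val) /= /eqP e; apply/val_inj/eqP => /=.
have {e}: a * i == a * j %[mod m].
  (* Adding [a * i + a * j] to both sides removes the natural subtractions. *)
  have := e; rewrite -(eqn_modDr (a * i + a * j)) => e'.
  have : s + a * j == s + a * i %[mod m].
    by move: e'; congr (_ == _ %[mod _]); have := le_f i; have := le_f j; lia.
  by rewrite eqn_modDl eq_sym.
wlog le_ij : i j / i <= j.
  by move=> H; case/orP: (leq_total i j) => /H // {}H; rewrite eq_sym => /H; rewrite eq_sym.
rewrite eq_sym eqn_mod_dvd; last by rewrite leq_mul2l le_ij orbT.
rewrite -mulnBr Gauss_dvdr 1?coprime_sym //.
case: (posnP (j - i)) => [|ji_gt0 /(dvdn_leq ji_gt0)]; first by lia.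
by have := ltn_ord j; lia.
Qed.

Lemma sum_ord_double m : 2 * \sum_(i < m) i = m * m.-1.
Proof. by elim: m => [|m IH]; rewrite ?big_ord0 // big_ord_recr mulnDr IH /=; case: m {IH}; lia. Qed.

(** Sum the Euclidean divisions of [s - a * i] by [m]: the remainders are 0, ..., m - 1 in some
    order, and the dividends form an arithmetic progression. Doubling and cancelling [m] gives the
    formula. *)
Lemma coprime_floor_sum a m s : coprime a m -> 0 < m -> a * m <= s ->
  2 * \sum_(i < m) ((s - a * i) %/ m) + a.+1 * m.-1 = 2 * s.
Proof.
move=> co_am m_gt0 le_s.
have sumD : \sum_(i < m) (s - a * i) =
    (\sum_(i < m) ((s - a * i) %/ m)) * m + \sum_(r < m) r.
  rewrite -(@coprime_residue_sum _ _ _ id co_am le_s) big_distrl -big_split /=.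
  by apply: eq_bigr => i _; exact: divn_eq.
have sumA : \sum_(i < m) (s - a * i) + a * \sum_(i < m) i = m * s.
  rewrite big_distrr -big_split /= (eq_bigr (fun=> s)) => [|i _].
    by rewrite sum_nat_const card_ord.
  have : a * i <= a * m by rewrite leq_mul2l (ltnW (ltn_ord i)) orbT.
  by lia.
have d := sum_ord_double m.
apply/eqP; rewrite -(eqn_pmul2l m_gt0); apply/eqP.
move: sumD sumA d; move: (\sum_(i < m) (s - a * i)) (\sum_(i < m) _ %/ _) (\sum_(i < m) i) (m.-1) => A B C m'.
by nia.
Qed.

(** The indicator of multiples of [c] has series 1/(1 - T^c), so this one has 1/((1 - T^b)(1 -
    T^c)): it counts the pairs (j, l) of naturals with bj + cl = n. *)
Definition denumerant2 b c : nat -> nat :=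
  weighted_conv b (fun n => (c %| n : nat)).

Definition denumerant3 a b c : nat -> nat := weighted_conv a (denumerant2 b c).

(** The [c] new terms meet every residue mod [c] once, so exactly one of them is divisible by
    [c]. *)
Lemma denumerant2_shift b c n : 0 < b -> 0 < c -> coprime b c ->
  denumerant2 b c (n + b * c) = (denumerant2 b c n).+1.
Proof.
move=> b_gt0 c_gt0 co_bc; rewrite /denumerant2 weighted_conv_shift //.
rewrite (eq_bigr (fun i : 'I_c => ((n + b * c - b * i) %% c == 0 : nat))) //.
rewrite (@coprime_residue_sum _ _ _ (fun r => (r == 0 : nat))) ?leq_addl //.
by case: c c_gt0 {co_bc} => // c _; rewrite big_ord_recl big1.
Qed.

Lemma denumerant2_divn b c n : 0 < b -> 0 < c -> coprime b c ->
  denumerant2 b c n = n %/ (b * c) + denumerant2 b c (n %% (b * c)).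
Proof.
move=> b_gt0 c_gt0 co_bc; rewrite {1}(divn_eq n (b * c)) addnC.
elim: (n %/ _) => [|q IH]; first by rewrite mul0n addn0.
by rewrite mulSnr addnA denumerant2_shift // IH addSn.
Qed.

Lemma sum_dvdn c n : 0 < c -> \sum_(s < n) (c %| s : nat) = (n + c.-1) %/ c.
Proof.
move=> c_gt0; elim: n => [|n IH]; first by rewrite big_ord0 divn_small //; lia.
rewrite big_ord_recr /= IH addSnnS prednK //.
have -> : (n + c) %/ c = (n %/ c).+1 by rewrite -[X in n + X]mul1n addnC divnMDl.
case/boolP: (c %| n) => [/dvdnP[q ->]|ndvd].
  by rewrite divnMDl // mulnK // divn_small; lia.
rewrite addn0 {1}(divn_eq n c) -addnA divnMDl //.
have r_gt0 : 0 < n %% c by rewrite lt0n.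
have -> : n %% c + c.-1 = 1 * c + (n %% c).-1 by lia.
rewrite divnMDl // [X in _ + (_ + X)]divn_small ?addn0 ?addn1 //.
by have := ltn_pmod n c_gt0; lia.
Qed.

(** This counts the lattice points with bj + cl < bc. For fixed [j] their number is the ceiling of
    (bc - bj)/c; written as a floor, it falls under [coprime_floor_sum] with s = bc + c - 1. *)
Lemma sum_denumerant2 b c : 0 < b -> 0 < c -> coprime b c ->
  2 * \sum_(r < b * c) denumerant2 b c r + 1 = b * c + b + c.
Proof.
move=> b_gt0 c_gt0 co_bc.
have -> : \sum_(r < b * c) denumerant2 b c r
    = \sum_(j < c) ((b * c + c.-1 - b * j) %/ c).
  under eq_bigr => r _ do rewrite /denumerant2 (weighted_conv_widen _ _ _ c) //.
  rewrite (exchange_big_dep predT) //=; apply: eq_bigr => j _.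
  have le_bj : b * j <= b * c by rewrite leq_mul2l (ltnW (ltn_ord j)) orbT.
  have -> : b * c + c.-1 - b * j = b * c - b * j + c.-1 by lia.
  rewrite -sum_dvdn // -(big_mkord (fun r => b * j <= r) (fun r => (c %| r - b * j : nat))).
  rewrite (@big_cat_nat _ _ _ (b * j)) //= big_nat_cond big1 ?add0n; last by move=> i; lia.
  rewrite -{1}[b * j]add0n big_addn -[RHS](big_mkord xpredT (fun s => (c %| s : nat))).
  by apply: eq_big => i; rewrite ?leq_addl // addnK.
have := @coprime_floor_sum b c (b * c + c.-1) co_bc c_gt0 (leq_addr _ _).
by case: c c_gt0 {co_bc} => //= c _; move: (\sum_(i < _) _) => S; nia.
Qed.

Lemma denumerant3_shift a b c n : 0 < a -> 0 < b -> 0 < c ->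
  coprime a b -> coprime a c -> coprime b c ->
  2 * denumerant3 a b c (n + a * b * c)
    = 2 * denumerant3 a b c n + 2 * n + a * b * c + (a + b + c).
Proof.
move=> a_gt0 b_gt0 c_gt0 co_ab co_ac co_bc.
have co_a : coprime a (b * c) by rewrite coprimeMr co_ab.
have bc_gt0 : 0 < b * c by rewrite muln_gt0 b_gt0.
rewrite -mulnA /denumerant3 weighted_conv_shift //.
(* The quotients by [b * c] add up by [coprime_floor_sum]; the values at the residues fill one full
   period, given by [sum_denumerant2]. *)
under eq_bigr => i _ do rewrite denumerant2_divn //.
rewrite big_split /= (@coprime_residue_sum _ _ _ _ co_a (leq_addl _ _)).
have := sum_denumerant2 b c b_gt0 c_gt0 co_bc.
have := @coprime_floor_sum a (b * c) (n + a * (b * c)) co_a bc_gt0 (leq_addl _ _).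
move: (weighted_conv _ _ _) (\sum_(i < _) _) (\sum_(i < _) _) => A B C.
by move: bc_gt0; case: (b * c) => // m _ /=; nia.
Qed.

Lemma denumerant3_divn a b c q n : 0 < a -> 0 < b -> 0 < c ->
  coprime a b -> coprime a c -> coprime b c ->
  2 * denumerant3 a b c (a * b * c * q + n)
    = 2 * denumerant3 a b c n + a * b * c * q ^ 2 + 2 * q * n + q * (a + b + c).
Proof.
move=> a_gt0 b_gt0 c_gt0 co_ab co_ac co_bc; elim: q => [|q IH].
  by rewrite !(muln0, mul0n, addn0, add0n).
have -> : a * b * c * q.+1 + n = a * b * c * q + n + a * b * c by lia.
by rewrite denumerant3_shift // IH; move: (a * b * c) (a + b + c) => x e; nia.
Qed.

(** * Monomials of given weighted degree as lattice points *)

Lemma denumerant3E a b c n : 0 < a -> 0 < b -> 0 < c ->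
  denumerant3 a b c n
    = #|[pred p : 'I_n.+1 * 'I_n.+1 * 'I_n.+1 | a * p.1.1 + b * p.1.2 + c * p.2 == n]|.
Proof.
move=> a_gt0 b_gt0 c_gt0.
rewrite -sum1_card big_mkcond /=.
rewrite -(pair_bigA _ (fun (p : 'I_n.+1 * 'I_n.+1) (l : 'I_n.+1) =>
  if a * p.1 + b * p.2 + c * l == n then 1 else 0)) /=.
rewrite -(pair_bigA _ (fun i j : 'I_n.+1 =>
  \sum_(l < n.+1) if a * i + b * j + c * l == n then 1 else 0)) /=.
rewrite /denumerant3 /weighted_conv big_mkcond /=; apply: eq_bigr => i _.
case: ifP => [le_i|gt_i]; last first.
  by rewrite big1 // => j _; rewrite big1 // => l _; case: eqP => //; lia.
rewrite /denumerant2 (weighted_conv_widen _ _ _ n.+1); last first.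
  by have := leq_pmull n.+1 b_gt0; lia.
rewrite big_mkcond /=; apply: eq_bigr => j _.
case: ifP => [le_j|gt_j]; last first.
  by rewrite big1 // => l _; case: eqP => //; lia.
(* For fixed [i] and [j] at most one [l] solves the equation, and one exists exactly when [c]
   divides what is left. *)
case/boolP: (c %| _) => [/dvdnP[q def_q]|ndvd]; last first.
  rewrite big1 // => l _; case: eqP => // e; case/negP: ndvd.
  by apply/dvdnP; exists l; lia.
have lt_q : q < n.+1 by have := leq_pmulr q c_gt0; lia.
rewrite (bigD1 (Ordinal lt_q)) //= big1 ?addn0 => [|l ne_l]; first by case: eqP => //; lia.
case: eqP => // e; case/eqP: ne_l; apply: val_inj => /=.
by apply/eqP; rewrite -(eqn_pmul2l c_gt0); apply/eqP; lia.
Qed.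

Lemma dimS_weights3 (k : fieldType) a b c n
    (a_gt0 : 0 < a) (b_gt0 : 0 < b) (c_gt0 : 0 < c) :
  dimS k (weights3 a_gt0 b_gt0 c_gt0) n = denumerant3 a b c n.
Proof.
set w := weights3 _ _ _.
have wdegE (m : 'X_{1..3}) :
    wdeg w m = a * m ord0 + b * m (inord 1) + c * m (inord 2).
  rewrite /wdeg !big_ord_recl big_ord0 addn0 addnA.
  have -> : inord 1 = lift ord0 ord0 :> 'I_3 by apply: val_inj; rewrite /= inordK.
  have -> : inord 2 = lift ord0 (lift ord0 ord0) :> 'I_3.
    by apply: val_inj; rewrite /= inordK.
  by [].
have ltm (m : 'X_{1..3 < n.+1}) i : m i < n.+1.
  apply: leq_ltn_trans (bmdeg m).
  by rewrite mdegE (bigD1 i) //= leq_addr.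
pose f (m : 'X_{1..3 < n.+1}) : 'I_n.+1 * 'I_n.+1 * 'I_n.+1 :=
  (Ordinal (ltm m ord0), Ordinal (ltm m (inord 1)), Ordinal (ltm m (inord 2))).
pose g0 (p : 'I_n.+1 * 'I_n.+1 * 'I_n.+1) : 'X_{1..3} :=
  [multinom nth 0 [:: (p.1.1 : nat); (p.1.2 : nat); (p.2 : nat)] i | i < 3].
(* The default [bm0] is never reached on triples of weighted degree [n], since the ordinary degree
   is at most the weighted one. *)
pose g p : 'X_{1..3 < n.+1} := insubd bm0 (g0 p).
have g0E p : wdeg w (g0 p) = a * p.1.1 + b * p.1.2 + c * p.2.
  by rewrite wdegE !mnmE !inordK.
rewrite dimSE denumerant3E // card_sig -!sum1_card.
rewrite [RHS](reindex f) /=; last first.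
  exists g => [m _|p]; last rewrite inE => /eqP def_n.
    rewrite /g; have -> : g0 (f m) = val m.
      apply/mnmP => i; rewrite mnmE /=.
      case: i => [[|[|[|i]]] lti] //=; congr (fun_of_multinom (val m) _).
      - exact: val_inj.
      - by apply: val_inj; rewrite /= inordK.
      - by apply: val_inj; rewrite /= inordK.
    exact: valKd.
  have vg : val (g p) = g0 p.
    rewrite /g val_insubd; case: ifP => // /negP[].
    by rewrite ltnS -def_n -g0E mdeg_le_wdeg.
  case: p vg {def_n} => [[i j] l] vg.
  by congr (_, _, _); apply: val_inj; rewrite /= vg mnmE ?inordK.
by apply: eq_bigl => m; rewrite !inE wdegE.
Qed.

End Denumerant.

(** * The bound on the quotient *)

Theorem theorem5p4 (k : fieldType) (R : rcfType) (a b c : nat)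
    (a_gt0 : (0 < a)%N) (b_gt0 : (0 < b)%N) (c_gt0 : (0 < c)%N)
    (coprime_ab : coprime a b) (coprime_ac : coprime a c)
    (coprime_bc : coprime b c)
    (xi eta : nat) (def_xi : xi = (a * b * c)%N) (def_eta : eta = (a + b + c)%N)
    (xi_eta : eta%:R < Num.sqrt (xi%:R : R))
    (n1 r1 : nat) (n1_gt0 : (0 < n1)%N) (r1_gt0 : (0 < r1)%N)
    (n1_r1 : n1%:R / r1%:R < Num.sqrt (xi%:R : R))
    (dim_n1 : (r1%:R * (r1%:R + 1) / 2%:R : R)
                < (dimS k (weights3 a_gt0 b_gt0 c_gt0) n1)%:R)
    (q1 : int) (v1 : nat) (lt_v1_xi : (v1 < xi)%N)
    (def_n1 : n1%:Z = xi%:Z * q1 + v1%:Z) :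
  q1%:~R < 2%:R * (dimS k (weights3 a_gt0 b_gt0 c_gt0) v1)%:R
         / (Num.sqrt (xi%:R : R) - eta%:R)
  /\
  n1%:R < 2%:R * xi%:R * (\max_(t < xi) dimS k (weights3 a_gt0 b_gt0 c_gt0) t)%:R
            / (Num.sqrt (xi%:R : R) - eta%:R) + xi%:R.
Proof.
(* As [v1 < xi], a negative [q1] would make [n1] negative. *)
have [q def_q] : exists q : nat, q1 = q%:Z.
  exists `|q1|%N; rewrite gez0_abs //; case: q1 def_n1 => // p def_n1.
  by have := leq_pmulr xi (ltn0Sn p); lia.
have {}def_n1 : n1 = (xi * q + v1)%N by rewrite def_q in def_n1; lia.
rewrite {}def_q {q1} -pmulrn.
set s := Num.sqrt _ in xi_eta n1_r1 *.
set D := dimS k _ in dim_n1 *.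
have xi_gt0 : (0 < xi)%N by rewrite def_xi !muln_gt0 a_gt0 b_gt0.
have s2 : s ^+ 2 = xi%:R by rewrite sqr_sqrtr ?ler0n.
have s_gt0 : 0 < s by rewrite sqrtr_gt0 ltr0n.
have gap_gt0 : 0 < s - eta%:R by rewrite subr_gt0.
have first_bound : q%:R < 2%:R * (D v1)%:R / (s - eta%:R).
  have D_n1 : 2 * (D n1)%:R =
      2 * (D v1)%:R + xi%:R * q%:R ^+ 2 + 2 * q%:R * v1%:R + q%:R * eta%:R :> R.
    rewrite -natrX -!natrM -!natrD /D !dimS_weights3 def_n1 def_xi def_eta.
    by rewrite denumerant3_divn.
  have r_gt0 : 0 < r1%:R :> R by rewrite ltr0n.
  have n1E : n1%:R = s ^+ 2 * q%:R + v1%:R :> R by rewrite s2 def_n1 natrD natrM.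
  set u : R := s * q%:R + v1%:R / s.
  have u_ge0 : 0 <= u by rewrite addr_ge0 ?mulr_ge0 ?invr_ge0 ?ler0n // ltW.
  have n1u : n1%:R = s * u by rewrite n1E /u; field; rewrite gt_eqF.
  have u_lt_r : u < r1%:R.
    by move: n1_r1; rewrite ltr_pdivrMr // n1u ltr_pM2l.
  rewrite ltr_pdivlMr //.
  have sum_lt : u ^+ 2 + u < 2 * (D n1)%:R by nra.
  (* In terms of t = v1 / s, the terms xi q^2 and 2 q v1 cancel against the expansion of u^2. This
     leaves q (s - eta) + t^2 + t < 2 D(v1), where t^2 + t is nonnegative. *)
  have [t t_ge0 [def_u v1E]] : exists2 t : R, 0 <= t & u = s * q%:R + t /\ v1%:R = s * t.
    exists (v1%:R / s); first by rewrite divr_ge0 ?ler0n // ltW.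
    by split=> //; field; rewrite gt_eqF.
  rewrite D_n1 -s2 def_u v1E in sum_lt.
  by have := sqr_ge0 t; lra.
split=> //.
have le_max : (D v1 <= \max_(t < xi) D t)%N.
  exact: (leq_bigmax (Ordinal lt_v1_xi)).
have xiR : 0 < xi%:R :> R by rewrite ltr0n.
have q_max : q%:R < 2 * (\max_(t < xi) D t)%:R / (s - eta%:R).
  apply: lt_le_trans first_bound _.
  by rewrite ler_pM2r ?invr_gt0 // ler_pM2l ?ltr0n // ler_nat.
rewrite def_n1 natrD natrM; apply: ltrD; last by rewrite ltr_nat.
by rewrite -(mulrA 2) (mulrCA 2) -!mulrA ltr_pM2l // mulrA.
Qed.
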